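(* Fix integers $n,k\ge 2$. The minimum $$\min\Bigl\{ f(\vec n) : \vec n=(n_1,\dots,n_k)\in\mathbb{N}^k,\ \sum_{i=1}^k n_i=n\Bigr\}$$ is attained only by assignments $\vec n=(n_1,\dots,n_k)\in\mathbb{N}^k$ satisfying $\sum_{i=1}^k n_i=n$ and $|n_i-n_j|\le 1$ for every $i,j\in\{1,\dots,k\}$. Here $f(\vec n)$ is the expected number of balls remaining at the end of the ball removal process started from $\vec n$ (defined in the context).
   Context: $\mathbb{N}=\{0,1,2,\dots\}$ and $[k]=\{1,\dots,k\}$. An assignment $\vec n=(n_1,\dots,n_k)\in\mathbb{N}^k$ puts $n_\ell$ balls in bin $\ell$, for each $\ell\in[k]$. Removal process: the sample space is $[k]^\infty$ with the product probability measure $\mathbf{P}$ under which the coordinates are independent and uniformly distributed on $[k]$. At each round $t\ge 1$ the bin given by the $t$-th coordinate is selected, and if that bin is non-empty, one ball is removed from it (otherwise nothing happens). Round $0$ refers to the initial configuration. For $\vec n$ not identically zero, let $T(\vec n)$ be the first round $t\ge 0$ at whose end there is exactly one non-empty bin (almost surely finite), and let $X_{\vec n}$ be the number of balls in that unique non-empty bin at round $T(\vec n)$. Define $f(\vec n):=\mathbf{E}[X_{\vec n}]$. (Equivalently in distribution: at each round a ball is removed from a bin chosen uniformly at random among the non-empty bins, the process stops when a single non-empty bin remains, and $X_{\vec n}$ is the number of balls then remaining.) *)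

(* Defs.v *)
From HB Require Import structures.
From mathcomp Require Import all_boot all_order all_algebra.
From mathcomp Require Import all_classical all_reals all_analysis.

Set Implicit Arguments.
Unset Strict Implicit.
Unset Printing Implicit Defensive.
Import Order.TTheory GRing.Theory Num.Theory.
Import numFieldNormedType.Exports.

Local Open Scope classical_set_scope.
Local Open Scope ring_scope.

HB.instance Definition _ (k : nat) := isPointed.Build 'I_k.+1 ord0.

(* Everything below has [k.+1] bins, indexed by ['I_k.+1], so that the sample
   space is inhabited, as a [measurableType] has to be.  Coordinates are indexed from
   0: the bin selected at round [t.+1] is [w t]. *)
Definition coordinate_events (k : nat) : set_system (nat -> 'I_k.+1) :=
  [set E | exists t i, E = [set w | w t = i]].

(* The sample space [k.+1]^oo with the product sigma-algebra. *)
Definition selections (k : nat) := g_sigma_algebraType (@coordinate_events k).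

Definition uniform_product_measure (R : realType) (k : nat)
    (P : probability (selections k) R) : Prop :=
  forall (N : nat) (A : nat -> {set 'I_k.+1}),
    P [set w : nat -> 'I_k.+1 | forall t, (t < N)%N -> w t \in A t] =
    (\prod_(t < N) (#|A t|%:R / k.+1%:R))%:E.

Section removal_process.
Context {k : nat}.
Implicit Types (m : {ffun 'I_k.+1 -> nat}) (w : nat -> 'I_k.+1) (t : nat).

(* Truncated subtraction: an empty bin stays empty. *)
Definition remove_ball m (l : 'I_k.+1) : {ffun 'I_k.+1 -> nat} :=
  [ffun i => m i - (i == l)]%N.

Fixpoint config m w t : {ffun 'I_k.+1 -> nat} :=
  if t is t'.+1 then remove_ball (config m w t') (w t') else m.

Definition nonempty_bins m : {set 'I_k.+1} := [set i | (0 < m i)%N].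

Definition one_nonempty_bin m w t : bool := #|nonempty_bins (config m w t)| == 1%N.

(* [None] if there is never exactly one non-empty bin. *)
Definition stopping_round m w : option nat :=
  if pselect (exists t, one_nonempty_bin m w t) is left ex_t
  then Some (ex_minn ex_t) else None.

(* At the stopping round the sum has a single term; the value 0 where the
   process never stops is immaterial, this being a null event for [m != 0]. *)
Definition remaining_balls m w : nat :=
  if stopping_round m w is Some t
  then (\sum_(i in nonempty_bins (config m w t)) config m w t i)%N else 0%N.

Definition expected_remaining (R : realType) (P : probability (selections k) R)
    m : \bar R :=
  'E_P[fun w => (remaining_balls m w)%:R].

End removal_process.

(* The product measure exists: it is the law of the base-[k.+1] digits of a
   point chosen uniformly in [0, 1]. *)
Section uniform_product_measure_exists.
Context {R : realType} (k : nat).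
Local Notation K := (k.+1%:R : R).

Definition digits (x : R) : selections k :=
  fun t => inord (Num.truncn (x * K ^+ t.+1) %% k.+1).

Let Kgt0 s : 0 < K ^+ s.
Proof. by rewrite exprn_gt0. Qed.

Lemma measurable_digits : measurable_fun [set: R] digits.
Proof.
apply: (@measurability _ _ R (selections k) setT digits (@coordinate_events k)).
  by [].
move=> _ [_ [t [i ->]] <-]; rewrite setTI.
have mle n : measurable [set x : R | (Num.truncn (x * K ^+ t.+1) < n)%N].
  case: n => [|n].
    by rewrite (_ : [set _ | _] = set0) // -subset0 => x.
  rewrite (_ : [set _ | _] = [set` `]-oo, (n.+1%:R / K ^+ t.+1)[%R]).
    exact: measurable_itv.
  apply/seteqP; split=> x /=; rewrite in_itv /= ltr_pdivlMr // ltnS truncn_le_nat //.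
rewrite (_ : _ @^-1` _ = \bigcup_(b in [set b | (b %% k.+1)%N = i])
  ([set x : R | (Num.truncn (x * K ^+ t.+1) < b.+1)%N] `\`
   [set x : R | (Num.truncn (x * K ^+ t.+1) < b)%N])).
  by apply: bigcup_measurable => b _; apply: measurableD.
apply/seteqP; split=> x /=.
- move=> /(congr1 val); rewrite /= inordK ?ltn_pmod // => h.
  exists (Num.truncn (x * K ^+ t.+1)) => //=; split => //.
  by rewrite ltnn.
- move=> [b /= h [h1 h2]]; apply: val_inj; rewrite /= inordK ?ltn_pmod // -h.
  congr (_ %% _)%N; apply/eqP; rewrite eqn_leq -ltnS h1 leqNgt; exact/negP.
Qed.

Let I s a := [set` `[(a%:R / K ^+ s), (a.+1%:R / K ^+ s)[%R] : set R.

Let divKS (y : R) s : y / K ^+ s.+1 * K ^+ s = y / K.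
Proof. by rewrite exprSr invfM mulrA mulrAC divfK ?gt_eqF. Qed.

Let I_S s a (i : 'I_k.+1) : I s.+1 (a * k.+1 + i)%N `<=` I s a.
Proof.
move=> x; rewrite /I /= !in_itv /= => /andP[h1 h2]; apply/andP; split.
  apply: le_trans h1; rewrite ler_pdivrMr // divKS ler_pdivlMr //.
  by rewrite -natrM ler_nat leq_addr.
apply: lt_le_trans h2 _; rewrite ler_pdivlMr // divKS ler_pdivrMr //.
by rewrite -natrM ler_nat mulSn -addnS addnC leq_add2r.
Qed.

Let I_digit s a (i : 'I_k.+1) x : I s.+1 (a * k.+1 + i)%N x -> digits x s = i.
Proof.
rewrite /I /= in_itv /= ler_pdivrMr // ltr_pdivlMr // => h.
apply: val_inj; rewrite /= inordK ?ltn_pmod // (truncn_def h).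
by rewrite modnMDl modn_small.
Qed.

Let I_split s a x : I s a x -> I s.+1 (a * k.+1 + digits x s)%N x.
Proof.
rewrite /I /= !in_itv /= ler_pdivrMr // ltr_pdivlMr // => /andP[h1 h2].
have x0 : 0 <= x.
  by rewrite -(pmulr_lge0 _ (Kgt0 s)); apply: le_trans h1.
rewrite ler_pdivrMr // ltr_pdivlMr // inordK ?ltn_pmod //.
have y0 : 0 <= x * K ^+ s.+1 by rewrite mulr_ge0 // ltW.
set b := Num.truncn _.
have -> : (a * k.+1 + b %% k.+1 = b)%N.
  rewrite [RHS](divn_eq b k.+1); congr (_ * _ + _)%N.
  apply/eqP; rewrite eqn_leq leq_divRL // -[(_ %/ _ <= _)%N]ltnS ltn_divLR //; apply/andP; split.
    by rewrite truncn_ge_nat // natrM exprSr mulrA ler_pM2r.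
  by rewrite truncn_lt_nat // natrM exprSr mulrA ltr_pM2r.
exact: truncn_itv.
Qed.

Let rect (N : nat) (A : nat -> {set 'I_k.+1}) s :=
  [set x : R | forall t, (t < N)%N -> digits x (s + t)%N \in A t].

Let measurable_rect N A s : measurable (rect N A s).
Proof.
rewrite (_ : rect N A s = \bigcap_(t in [set t | (t < N)%N])
  \bigcup_(i in [set i | i \in A t])
   (digits @^-1` [set w : nat -> 'I_k.+1 | w (s + t)%N = i])); last first.
  apply/seteqP; split=> x /= h t /= /h; first by exists (digits x (s + t)%N).
  by case=> i /= iA ->.
apply: bigcap_measurableType => // t _; apply: fin_bigcup_measurable => // i _.
rewrite -[X in measurable X]setTI; apply: measurable_digits => //.
by apply: sub_sigma_algebra; exists (s + t)%N, i.
Qed.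

Let mu := @lebesgue_measure R.

Let mu_rect N A s a :
  mu (I s a `&` rect N A s) =
  ((K ^+ s)^-1 * \prod_(t < N) (#|A t|%:R / K))%:E.
Proof.
elim: N A s a => [|N IH] A s a.
  rewrite (_ : rect 0 A s = setT) ?setIT; last by apply/seteqP; split.
  rewrite big_ord0 mulr1 /I /mu lebesgue_measure_itv /= lte_fin.
  rewrite ltr_pM2r ?invr_gt0 // ltr_nat ltnSn -EFinB -mulrBl.
  by rewrite -natr1 addrAC subrr add0r mul1r.
have -> : I s a `&` rect N.+1 A s = \big[setU/set0]_(i < k.+1 | i \in A 0%N)
   (I s.+1 (a * k.+1 + i)%N `&` rect N (A \o S) s.+1).
  rewrite -bigcup_seq_cond; apply/seteqP; split => x.
    move=> [/I_split h1 h2]; exists (digits x s).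
      by rewrite /= mem_index_enum -[s in digits x s]addn0; apply: h2.
    by split=> // t tN /=; rewrite addSnnS; apply: h2.
  move=> [i /andP[_ iA] [h1 h2]]; split; first exact: I_S h1.
  case=> [_|t tN]; first by rewrite addn0 (I_digit h1).
  by rewrite -addSnnS; apply: (h2 t).
transitivity (\sum_(i < k.+1 | i \in A 0%N)
    mu (I s.+1 (a * k.+1 + i)%N `&` rect N (A \o S) s.+1))%E.
  apply: (@measure_bigsetU_ord _ _ _ (@lebesgue_measure R)).
    by move=> i; apply: measurableI; [exact: measurable_itv|exact: measurable_rect].
  by move=> i j _ _ [x [[hi _] [hj _]]]; rewrite -(I_digit hi) (I_digit hj).
rewrite (eq_bigr _ (fun i _ => IH _ _ _)) sumEFin sumr_const big_ord_recl /=.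
congr EFin; rewrite -[LHS]mulr_natl !mulrA; congr (_ * _).
by rewrite exprSr invfM mulrA (mulrC _%:R).
Qed.

Let uniform01E (U : set R) : measurable U ->
  uniform_prob (@ltr01 R) U = mu (I 0 0 `&` U).
Proof.
move=> mU; rewrite /uniform_prob integral_uniform_pdf.
rewrite (eq_integral (cst 1%E)); last first.
  move=> x; rewrite inE /= => -[_]; rewrite in_itv /= /uniform_pdf => ->.
  by rewrite subr0 invr1.
rewrite integral_cst ?mul1e; last exact: measurableI.
rewrite setIC (_ : [set` _] `&` U = (I 0 0 `&` U) `|` ([set 1] `&` U)); last first.
  rewrite -setIUl; congr (_ `&` _); apply/seteqP; split=> x /=;
    rewrite /I /= ?in_itv /= expr0 mul0r divr1.
    by move=> /andP[-> /=]; rewrite le_eqVlt => /orP[/eqP|]; [right|left].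
  by move=> [/andP[-> /ltW]//|->]; rewrite ler01 lexx.
have m1U : measurable ([set 1%R] `&` U).
  by apply: measurableI => //; exact: measurable_set1.
apply: (@measureU0 _ _ _ (@lebesgue_measure R)) => //.
  by apply: measurableI => //; exact: measurable_itv.
apply/eqP; rewrite -measure_le0 -(lebesgue_measure_set1 (1%R : R)).
by apply: le_measure; rewrite ?inE //; exact: subIsetl.
Qed.

Lemma uniform_product_measure_exists :
  exists P : probability (selections k) R, uniform_product_measure P.
Proof.
have mX : measurable_fun [set: measurableTypeR R]
    (digits : measurableTypeR R -> selections k).
  exact: measurable_digits.
pose X : {mfun measurableTypeR R >-> selections k} :=
  HB.pack_for {mfun measurableTypeR R >-> selections k}
    (digits : measurableTypeR R -> selections k)
    (isMeasurableFun.Build _ _ (measurableTypeR R) (selections k) digits mX).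
exists (distribution (uniform_prob (@ltr01 R)) X) => N A.
rewrite [LHS](uniform01E (measurable_rect N A 0%N)).
by have := mu_rect N A 0 0; rewrite expr0 invr1 mul1r.
Qed.

End uniform_product_measure_exists.

(* Main.v *)
(* In continuous time, with each bin selected by its own rate-1 Poisson clock, the
   bins empty independently: bin [l] is empty at time [t] with probability
   F_(n_l)(t) = P(Poisson(t) >= n_l), non-empty with probability Q_(n_l) = 1 - F_(n_l).
   Let Psi(t) be the probability that exactly one bin is non-empty at time [t].
   By optional stopping f(n) is the integral of Psi.  Below this integral is replaced
   by an antiderivative V of Psi with V(0) = 0: as Psi' is the sum over the bins [l]
   of Psi_(n - e_l) - Psi_n, such a V is a linear combination of Psi and of the V's
   of the configurations with one ball less, and its limit at infinity satisfies the
   same recursion as f.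

   Moving a ball from a bin with the maximal number a + 1 of balls to a bin with b < a
   balls strictly decreases f.  Write p_j for the Poisson weights, A and B for the
   probabilities that none, resp. exactly one, of the other bins is non-empty.  The
   difference of the two Psi's is A (H + G) - B G, with
     G = p_a F_(b+1) - p_b F_(a+1) >= 0 and H = p_b Q_(a+1) - p_a Q_(b+1) >= 0.
   Since the other bins have at most a + 1 balls, B G <= A' S with
   S = Q_(a+1) G / p_a; integrating A' S by parts turns it into - A S', where
   S' = - G - Q_(a+1) F_(a+1) (p_b / p_a)', so that the G's cancel and what remains
   is positive because p_b / p_a decreases. *)

Require Import Defs.
From mathcomp Require Import all_boot all_order all_algebra.
From mathcomp Require Import all_classical all_reals all_analysis.
From mathcomp Require Import measurable_realfun ring lra zify.
Import Order.TTheory GRing.Theory Num.Theory.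
Import numFieldNormedType.Exports.
Local Open Scope classical_set_scope.
Local Open Scope ring_scope.
Set Implicit Arguments.
Unset Strict Implicit.
Unset Printing Implicit Defensive.

(** * Poisson weights *)

Section derive_pointwise.
Context {R : realType}.
Implicit Types (f g : R -> R) (t : R).

Lemma is_derive_addf f g t df dg : is_derive t 1 f df -> is_derive t 1 g dg ->
  is_derive t 1 (fun x => f x + g x) (df + dg).
Proof. exact: is_deriveD. Qed.

Lemma is_derive_subf f g t df dg : is_derive t 1 f df -> is_derive t 1 g dg ->
  is_derive t 1 (fun x => f x - g x) (df - dg).
Proof. exact: is_deriveB. Qed.

Lemma is_derive_mulf f g t df dg : is_derive t 1 f df -> is_derive t 1 g dg ->
  is_derive t 1 (fun x => f x * g x) (df * g t + f t * dg).
Proof.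
move=> fP gP; apply: (is_derive_eq (is_deriveM fP gP)).
by rewrite /GRing.scale /=; ring.
Qed.

Lemma is_derive_sumf (I : Type) (r : seq I) (Q : pred I)
    (f : I -> R -> R) (df : I -> R) t :
  (forall i, Q i -> is_derive t 1 (f i) (df i)) ->
  is_derive t 1 (fun x => \sum_(i <- r | Q i) f i x) (\sum_(i <- r | Q i) df i).
Proof.
move=> fP; elim: r => [|i r IH].
  rewrite big_nil (_ : (fun _ => _) = cst 0); first exact: is_derive_cst.
  by apply/funext => x; rewrite big_nil.
rewrite big_cons (_ : (fun _ => _) = fun x => if Q i then
  f i x + \sum_(i <- r | Q i) f i x else \sum_(i <- r | Q i) f i x); last first.
  by apply/funext => x; rewrite big_cons.
by case: ifP => // /fP fiP; exact: is_derive_addf.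
Qed.

Lemma is_derive_gt0_lt f (df : R -> R) (x y : R) : x < y ->
  (forall z, x <= z <= y -> is_derive z 1 f (df z)) ->
  (forall z, x < z < y -> 0 < df z) -> f x < f y.
Proof.
move=> xy fP df0.
have [||c] := @MVT _ f df x y xy.
- by move=> z; rewrite in_itv /= => /andP[/ltW xz /ltW zy]; apply: fP; rewrite xz.
- apply: derivable_within_continuous => z; rewrite in_itv /= => /fP ?.
  exact: ex_derive.
- rewrite in_itv /= => /df0 c0 /eqP; rewrite subr_eq => /eqP ->.
  by rewrite ltrDr mulr_gt0 // subr_gt0.
Qed.

End derive_pointwise.

Section poisson.
Context {R : realType}.
Implicit Types (j n : nat) (t : R) (s : seq nat).

(** In the notation of the overview, [poisson j], [poisson_lt n] and [poisson_ge n] are p_j, Q_n and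
    F_n. *)
Definition poisson j t : R := expR (- t) * t ^+ j / j`!%:R.

Definition poisson_lt n t : R := \sum_(j < n) poisson j t.

Definition poisson_ge n t : R := 1 - poisson_lt n t.

(** The weight p_(n-1) with p_(-1) = 0, so that the derivative formulas also cover empty bins. *)
Definition poisson_pred n t : R := if n is j.+1 then poisson j t else 0.

Lemma poisson_ge0 j t : 0 <= t -> 0 <= poisson j t.
Proof. by move=> t0; rewrite /poisson divr_ge0 // mulr_ge0 ?expR_ge0 ?exprn_ge0. Qed.

Lemma poisson_gt0 j t : 0 < t -> 0 < poisson j t.
Proof.
by move=> t0; rewrite /poisson divr_gt0 ?ltr0n ?fact_gt0 // mulr_gt0 ?expR_gt0
  ?exprn_gt0.
Qed.

Lemma poisson_at0 j : poisson j 0 = (j == 0)%:R.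
Proof.
rewrite /poisson oppr0 expR0 mul1r; case: j => [|j]; rewrite ?exprS ?mul0r //.
by rewrite expr0 fact0 divr1.
Qed.

Lemma mul_poisson j t : t * poisson j t = j.+1%:R * poisson j.+1 t.
Proof.
rewrite /poisson factS natrM exprS; field.
by rewrite nat1r !pnatr_eq0 -!lt0n fact_gt0.
Qed.

Lemma poisson_ltS n t : poisson_lt n.+1 t = poisson_lt n t + poisson n t.
Proof. by rewrite /poisson_lt big_ord_recr. Qed.

Lemma poisson_lt0 t : poisson_lt 0 t = 0.
Proof. by rewrite /poisson_lt big_ord0. Qed.

Lemma poisson_lt_at0 n : poisson_lt n 0 = (0 < n)%:R.
Proof.
elim: n => [|n IH]; first by rewrite poisson_lt0.
by rewrite poisson_ltS IH poisson_at0; case: n {IH} => [|n]; rewrite ?addr0 ?add0r.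
Qed.

Lemma poisson_lt_ge0 n t : 0 <= t -> 0 <= poisson_lt n t.
Proof. by move=> t0; apply: sumr_ge0 => j _; exact: poisson_ge0. Qed.

Lemma poisson_ge_0 t : poisson_ge 0 t = 1.
Proof. by rewrite /poisson_ge poisson_lt0 subr0. Qed.

Lemma poisson_geS n t : poisson_ge n t = poisson_ge n.+1 t + poisson n t.
Proof. by rewrite /poisson_ge poisson_ltS; lra. Qed.

Lemma is_derive_poisson j t :
  is_derive t 1 (poisson j) (poisson_pred j t - poisson j t).
Proof.
have D1 : is_derive t 1 (fun u : R => expR (- u)) (- expR (- t)).
  apply: (is_derive_eq (is_derive1_comp (is_derive_expR _) (is_deriveNid _ _))).
  by rewrite mulrN1.
have D2 : is_derive t 1 (fun u : R => u ^+ j) (j%:R * t ^+ j.-1).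
  rewrite (_ : (fun _ => _) = (@id R) ^+ j); last by rewrite exprfctE.
  apply: (is_derive_eq (is_deriveX j (is_derive_id t 1))).
  by rewrite /GRing.scale /= mulr1.
have D3 : is_derive t 1 (cst (j`!%:R^-1 : R)) 0 := is_derive_cst _ _ _.
apply: (is_derive_eq (is_derive_mulf (is_derive_mulf D1 D2) D3)).
rewrite /poisson; case: j {D1 D2 D3} => [|j] /=; first by rewrite fact0 invr1; ring.
rewrite factS natrM /poisson; field.
by rewrite nat1r !pnatr_eq0 -!lt0n fact_gt0.
Qed.

Lemma is_derive_poisson_lt n t : is_derive t 1 (poisson_lt n) (- poisson_pred n t).
Proof.
elim: n => [|n IH].
  rewrite (_ : poisson_lt 0 = cst 0); last by apply/funext => u; rewrite poisson_lt0.
  by rewrite oppr0; exact: is_derive_cst.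
rewrite (_ : poisson_lt n.+1 = fun u => poisson_lt n u + poisson n u); last first.
  by apply/funext => u; rewrite poisson_ltS.
by apply: (is_derive_eq (is_derive_addf IH (is_derive_poisson n t))) => /=; ring.
Qed.

Lemma is_derive_poisson_ge n t : is_derive t 1 (poisson_ge n) (poisson_pred n t).
Proof.
apply: (is_derive_eq (is_derive_subf (is_derive_cst (1 : R) t 1)
  (is_derive_poisson_lt n t))).
by rewrite sub0r opprK.
Qed.

Lemma poisson_ge_at0 n : poisson_ge n 0 = (n == 0)%:R.
Proof. by rewrite /poisson_ge poisson_lt_at0; case: n => [|n]; rewrite ?subr0 ?subrr. Qed.

Lemma poisson_ge_gt0 n t : 0 < t -> 0 < poisson_ge n t.
Proof.
case: n => [|n] t0; first by rewrite poisson_ge_0.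
rewrite -[ltLHS](poisson_ge_at0 n.+1).
apply: (is_derive_gt0_lt t0) => [z _|z /andP[z0 _]].
  exact: is_derive_poisson_ge.
exact: poisson_gt0.
Qed.

Lemma poisson_ge_ge0 n t : 0 <= t -> 0 <= poisson_ge n t.
Proof.
rewrite le_eqVlt => /predU1P[<-|t0]; first by rewrite poisson_ge_at0.
exact/ltW/poisson_ge_gt0.
Qed.

Lemma poisson_ge_le1 n t : 0 <= t -> poisson_ge n t <= 1.
Proof. by move=> t0; rewrite lerBlDr lerDl poisson_lt_ge0. Qed.

(** The difference of the two sides vanishes at 0 and has derivative [poisson_ge n], because t
    p_(n-1) = n p_n. *)
Lemma poisson_ge_mul n t : 0 <= t ->
  n%:R * poisson_ge n.+1 t <= t * poisson_ge n t.
Proof.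
rewrite le_eqVlt => /predU1P[<-|t0]; first by rewrite !poisson_ge_at0 mulr0 mul0r.
pose f u : R := u * poisson_ge n u - n%:R * poisson_ge n.+1 u.
rewrite -subr_ge0 -/(f t).
have <- : f 0 = 0 by rewrite /f !poisson_ge_at0 mulr0 mul0r subrr.
apply/ltW; apply: (@is_derive_gt0_lt _ f (poisson_ge n) _ _ t0) => z; last first.
  by move=> /andP[z0 _]; exact: poisson_ge_gt0.
move=> _; apply: (is_derive_eq (is_derive_subf
  (is_derive_mulf (is_derive_id z 1) (is_derive_poisson_ge n z))
  (is_derive_mulf (is_derive_cst (n%:R : R) z 1) (is_derive_poisson_ge n.+1 z)))).
case: n {f} => [|n] /=; first by ring.
by rewrite mul_poisson; ring.
Qed.

(** Termwise, t p_j = (j+1) p_(j+1) with j + 1 <= n. *)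
Lemma poisson_lt_mul n t : 0 <= t ->
  t * poisson_lt n t <= n%:R * poisson_lt n.+1 t.
Proof.
move=> t0; elim: n => [|n IH]; first by rewrite poisson_lt0 mulr0 mul0r.
rewrite poisson_ltS mulrDr mul_poisson (poisson_ltS n.+1) mulrDr -natr1.
have := poisson_lt_ge0 n.+1 t0; lra.
Qed.

(** F_(c+1) / p_c is nonincreasing in c: from c to c + 1, multiply by c + 1 to turn p_(c+1) into t
    p_c and use [poisson_ge_mul]. This gives G >= 0. *)
Lemma poisson_ge_cross b a t : 0 < t -> (b <= a)%N ->
  poisson b t * poisson_ge a.+1 t <= poisson a t * poisson_ge b.+1 t.
Proof.
move=> t0; elim: a => [|a IH]; first by rewrite leqn0 => /eqP ->.
rewrite leq_eqVlt => /predU1P[->//|/IH {}IH].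
have e := congr1 (fun x => x * poisson_ge b.+1 t) (mul_poisson a t).
rewrite -(@ler_pM2l _ a.+1%:R) //.
have h1 := ler_wpM2l (poisson_ge0 b (ltW t0)) (poisson_ge_mul a.+1 (ltW t0)).
have h2 := ler_wpM2l (ltW t0) IH.
move: e => /=; lra.
Qed.

(** Likewise Q_(c+1) / p_c is nondecreasing in c, by [poisson_lt_mul]. This gives H >= 0. *)
Lemma poisson_lt_cross b a t : 0 < t -> (b <= a)%N ->
  poisson a t * poisson_lt b.+1 t <= poisson b t * poisson_lt a.+1 t.
Proof.
move=> t0; elim: a => [|a IH]; first by rewrite leqn0 => /eqP ->.
rewrite leq_eqVlt => /predU1P[->//|/IH {}IH].
have e := congr1 (fun x => x * poisson_lt b.+1 t) (mul_poisson a t).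
rewrite -(@ler_pM2l _ a.+1%:R) //.
have h1 := ler_wpM2l (poisson_ge0 b (ltW t0)) (poisson_lt_mul a.+1 (ltW t0)).
have h2 := ler_wpM2l (ltW t0) IH.
move: e => /=; lra.
Qed.

End poisson.

(** * Independently emptying bins *)

Section independent_bins.
Context {R : realType}.
Implicit Types (c n : nat) (t : R) (s r : seq nat).

(** For a list [s] of bin contents, [all_empty] and [one_left] are the probabilities A and B (or
    Psi, for all bins) of the overview. The product formulas due to independence serve as
    definitions, so no continuous-time probability space is needed. *)
Definition all_empty s t : R := \prod_(c <- s) poisson_ge c t.

Definition one_left s t : R :=
  \sum_(c <- s) poisson_lt c t * all_empty (rem c s) t.

Fixpoint all_empty' s t : R := if s is c :: r
  then poisson_pred c t * all_empty r t + poisson_ge c t * all_empty' r t else 0.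

Fixpoint one_left' s t : R := if s is c :: r
  then - poisson_pred c t * all_empty r t + poisson_lt c t * all_empty' r t
       + (poisson_pred c t * one_left r t + poisson_ge c t * one_left' r t) else 0.

Lemma all_empty_nil t : all_empty [::] t = 1.
Proof. exact: big_nil. Qed.

Lemma one_left_nil t : one_left [::] t = 0.
Proof. exact: big_nil. Qed.

Lemma all_empty_cons c s t : all_empty (c :: s) t = poisson_ge c t * all_empty s t.
Proof. exact: big_cons. Qed.

Lemma perm_all_empty s r t : perm_eq s r -> all_empty s t = all_empty r t.
Proof. exact: perm_big. Qed.

(** This allows two chosen bins to be brought to the head of the list. *)
Lemma perm_one_left s r t : perm_eq s r -> one_left s t = one_left r t.
Proof.
move=> sr; rewrite /one_left (perm_big _ sr) [LHS]big_seq [RHS]big_seq.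
apply: eq_bigr => c cr; congr (_ * _); apply: perm_all_empty.
rewrite -(perm_cons c) -(permPl (perm_to_rem _)) ?(perm_mem sr) //.
by rewrite (permPl sr) perm_to_rem.
Qed.

Lemma one_left_cons c s t :
  one_left (c :: s) t = poisson_lt c t * all_empty s t + poisson_ge c t * one_left s t.
Proof.
rewrite /one_left big_cons /= eqxx; congr (_ + _).
rewrite mulr_sumr [LHS]big_seq [RHS]big_seq; apply: eq_bigr => x xs.
(* When x equals the head, [rem] deletes the head instead, which leaves a permutation of the same
   list. *)
have [<-|cx] := eqVneq x c; last by rewrite all_empty_cons mulrCA.
by rewrite (perm_all_empty _ (perm_to_rem xs)) all_empty_cons mulrCA.
Qed.

Lemma is_derive_all_empty s t : is_derive t 1 (all_empty s) (all_empty' s t).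
Proof.
elim: s => [|c s IH] /=.
  rewrite (_ : all_empty _ = cst 1); first exact: is_derive_cst.
  by apply/funext => u; rewrite all_empty_nil.
rewrite (_ : all_empty _ = fun u => poisson_ge c u * all_empty s u).
  exact: is_derive_mulf (is_derive_poisson_ge c t) IH.
by apply/funext => u; rewrite all_empty_cons.
Qed.

Lemma is_derive_one_left s t : is_derive t 1 (one_left s) (one_left' s t).
Proof.
elim: s => [|c s IH] /=.
  rewrite (_ : one_left _ = cst 0); first exact: is_derive_cst.
  by apply/funext => u; rewrite one_left_nil.
rewrite (_ : one_left _ =
    fun u => poisson_lt c u * all_empty s u + poisson_ge c u * one_left s u).
  apply: is_derive_addf; apply: is_derive_mulf => //.
  - exact: is_derive_poisson_lt.
  - exact: is_derive_all_empty.
  - exact: is_derive_poisson_ge.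
by apply/funext => u; rewrite one_left_cons.
Qed.

Lemma all_empty_gt0 s t : 0 < t -> 0 < all_empty s t.
Proof.
by move=> t0; elim: s => [|c s IH]; rewrite ?all_empty_nil // all_empty_cons
  mulr_gt0 // poisson_ge_gt0.
Qed.

Lemma all_empty_le1 s t : 0 < t -> all_empty s t <= 1.
Proof.
move=> t0; elim: s => [|c s IH]; first by rewrite all_empty_nil.
rewrite all_empty_cons mulr_ile1 ?poisson_ge_ge0 ?poisson_ge_le1 ?(ltW t0) //.
exact/ltW/all_empty_gt0.
Qed.

(* Termwise: [poisson_lt c t / poisson c.-1 t] is nondecreasing in [c]. *)
Lemma one_left_le_all_empty' s a t : 0 < t -> (forall c, c \in s -> (c <= a.+1)%N) ->
  poisson a t * one_left s t <= poisson_lt a.+1 t * all_empty' s t.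
Proof.
move=> t0; elim: s => [|c s IH] sa; first by rewrite one_left_nil !mulr0.
rewrite one_left_cons /=.
have {}IH : poisson a t * one_left s t <= poisson_lt a.+1 t * all_empty' s t.
  by apply: IH => x xs; apply: sa; rewrite inE xs orbT.
have h : poisson a t * poisson_lt c t <= poisson_lt a.+1 t * poisson_pred c t.
  case: c {sa} (sa c (mem_head _ _)) => [_|c ca] /=.
    by rewrite poisson_lt0 !mulr0.
  by rewrite mulrC [leRHS]mulrC mulrC poisson_lt_cross.
have h1 := ler_wpM2r (ltW (all_empty_gt0 s t0)) h.
have h2 := ler_wpM2l (poisson_ge_ge0 c (ltW t0)) IH.
lra.
Qed.

(** * Values at time 0 and limits at infinity *)

Lemma all_empty_at0 s : all_empty s 0 = (all (pred1 0%N) s)%:R.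
Proof.
elim: s => [|c s IH]; first by rewrite all_empty_nil.
by rewrite all_empty_cons IH poisson_ge_at0 /=; case: c => [|c]; rewrite ?mul1r ?mul0r.
Qed.

Lemma one_left_at0 s : one_left s 0 = (count (fun c => 0 < c)%N s == 1%N)%:R.
Proof.
elim: s => [|c s IH]; first by rewrite one_left_nil.
rewrite one_left_cons poisson_lt_at0 poisson_ge_at0 IH all_empty_at0.
case: c => [|c] /=; rewrite !(mul1r, mul0r, add0r, addr0) // add1n eqSS.
congr (nat_of_bool _)%:R; elim: s {IH} => //= -[|c'] s /=.
  by rewrite add0n.
by rewrite add1n.
Qed.

(** t p_j = (j+1) p_(j+1), and p_(j+1) <= 1 by the exponential series. *)
Lemma poisson_le_inv j t : 0 < t -> poisson j t <= j.+1%:R / t.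
Proof.
move=> t0; rewrite ler_pdivlMr // mulrC mul_poisson ler_piMr //.
rewrite /poisson -mulrA expRN mulrC ler_pdivrMr ?expR_gt0 // mul1r.
by apply: le_trans (expR_ge1Dxn j (ltW t0)); rewrite lerDr.
Qed.

Lemma poisson_cvg0 j : poisson j t @[t --> +oo] --> (0 : R).
Proof.
apply: (@squeeze_cvgr _ _ _ _ (cst 0) (fun t => j.+1%:R / t)).
- near=> t; have t0 : 0 < t by near: t; apply: nbhs_pinfty_gt; exact: num_real.
  by rewrite /= poisson_ge0 ?(ltW t0) //= poisson_le_inv.
- exact: cvg_cst.
- rewrite -[0](mulr0 (j.+1%:R)); apply: cvgM; first exact: cvg_cst.
  by apply/(gtr0_cvgV0 (f := id)); [exact: nbhs_pinfty_gt|exact: cvg_id].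
Unshelve. all: by end_near. Qed.

Lemma poisson_lt_cvg0 n : poisson_lt n t @[t --> +oo] --> (0 : R).
Proof.
elim: n => [|n IH].
  by rewrite (_ : poisson_lt 0 = cst 0);
    [exact: cvg_cst|apply/funext => u; rewrite poisson_lt0].
rewrite (_ : poisson_lt _ = fun u => poisson_lt n u + poisson n u); last first.
  by apply/funext => u; rewrite poisson_ltS.
by rewrite -[0]addr0; apply: cvgD => //; exact: poisson_cvg0.
Qed.

Lemma poisson_ge_cvg1 n : poisson_ge n t @[t --> +oo] --> (1 : R).
Proof.
rewrite -[X in _ --> X]subr0; apply: cvgB; first exact: cvg_cst.
exact: poisson_lt_cvg0.
Qed.

Lemma all_empty_cvg1 s : all_empty s t @[t --> +oo] --> (1 : R).
Proof.
elim: s => [|c s IH].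
  by rewrite (_ : all_empty _ = cst 1);
    [exact: cvg_cst|apply/funext => u; rewrite all_empty_nil].
rewrite (_ : all_empty _ = fun u => poisson_ge c u * all_empty s u); last first.
  by apply/funext => u; rewrite all_empty_cons.
by rewrite -[1]mulr1; apply: cvgM => //; exact: poisson_ge_cvg1.
Qed.

Lemma one_left_cvg0 s : one_left s t @[t --> +oo] --> (0 : R).
Proof.
elim: s => [|c s IH].
  by rewrite (_ : one_left _ = cst 0);
    [exact: cvg_cst|apply/funext => u; rewrite one_left_nil].
rewrite (_ : one_left _ =
    fun u => poisson_lt c u * all_empty s u + poisson_ge c u * one_left s u); last first.
  by apply/funext => u; rewrite one_left_cons.
rewrite -[0]addr0 -[X in X + _](mul0r 1) -[X in _ + X](mulr0 1).
apply: cvgD; apply: cvgM => //.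
- exact: poisson_lt_cvg0.
- exact: all_empty_cvg1.
- exact: poisson_ge_cvg1.
Qed.

End independent_bins.

(** * Effect of moving one ball out of a fullest bin *)

Section moving_a_ball.
Context {R : realType}.
Variables (a b : nat) (s : seq nat).
Hypothesis lt_ba : (b < a)%N.
Implicit Types t : R.

Let G t : R := poisson a t * poisson_ge b.+1 t - poisson b t * poisson_ge a.+1 t.

Let H t : R := poisson b t * poisson_lt a.+1 t - poisson a t * poisson_lt b.+1 t.

Let rho t : R := poisson b t / poisson a t.

(* [all_empty s * S] is the boundary term of the integration by parts. *)
Let S t : R := poisson_lt a.+1 t * (poisson_ge b.+1 t - poisson_ge a.+1 t * rho t).

Let G_ge0 t : 0 < t -> 0 <= G t.
Proof. by move=> t0; rewrite subr_ge0 poisson_ge_cross // ltnW. Qed.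

Let H_ge0 t : 0 < t -> 0 <= H t.
Proof. by move=> t0; rewrite subr_ge0 poisson_lt_cross // ltnW. Qed.

Let SE t : 0 < t -> S t = poisson_lt a.+1 t * (G t / poisson a t).
Proof.
move=> t0; rewrite /S /G /rho; have := poisson_gt0 a t0.
move: (poisson a t) (poisson_lt _ _) => p q p0; field.
by rewrite gt_eqF.
Qed.

(** Only two bins differ: - G and H + G are the changes in the probability that none, resp. exactly
    one, of these two bins is non-empty. *)
Let one_left_move t :
  one_left (a.+1 :: b :: s) t - one_left (a :: b.+1 :: s) t =
  all_empty s t * (H t + G t) - G t * one_left s t.
Proof.
rewrite !one_left_cons !all_empty_cons /H /G (poisson_geS a) (poisson_geS b).
rewrite /poisson_ge !poisson_ltS; ring.
Qed.

Let is_derive_rho t : 0 < t -> is_derive t 1 rho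
  ((poisson_pred b t * poisson a t - poisson b t * poisson_pred a t) / poisson a t ^+ 2).
Proof.
move=> t0; have pa0 : poisson a t != 0 by rewrite gt_eqF // poisson_gt0.
apply: (is_derive_eq (is_derive_mulf (is_derive_poisson b t)
  (is_deriveV pa0 (is_derive_poisson a t)))).
rewrite /GRing.scale /=; move: (poisson a t) pa0 => p p0; field.
exact: p0.
Qed.

(** Since t p_(j-1) = j p_j, the left-hand side times t is (b - a) p_b p_a. *)
Let rho'_lt0 t : 0 < t ->
  poisson_pred b t * poisson a t - poisson b t * poisson_pred a t < 0.
Proof.
move=> t0; rewrite -(ltr_pM2l t0) mulr0.
have tp j : t * poisson_pred j t = j%:R * poisson j t.
  by case: j => [|j] /=; rewrite ?mulr0 ?mul0r // mul_poisson.
have -> : t * (poisson_pred b t * poisson a t - poisson b t * poisson_pred a t) =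
    t * poisson_pred b t * poisson a t - poisson b t * (t * poisson_pred a t).
  by ring.
rewrite !tp (_ : _ - _ = (b%:R - a%:R) * (poisson b t * poisson a t)); last by ring.
by rewrite nmulr_rlt0 ?subr_lt0 ?ltr_nat // mulr_gt0 ?poisson_gt0.
Qed.

(** In the product rule, the derivative p_b of F_(b+1) cancels against p_a [rho], and - p_a times
    the bracket of [S] is - G. *)
Let S' t : R := - G t - poisson_lt a.+1 t * poisson_ge a.+1 t *
  ((poisson_pred b t * poisson a t - poisson b t * poisson_pred a t) / poisson a t ^+ 2).

Let is_derive_S t : 0 < t -> is_derive t 1 S (S' t).
Proof.
move=> t0; have pa0 : poisson a t != 0 by rewrite gt_eqF // poisson_gt0.
apply: (is_derive_eq (is_derive_mulf (is_derive_poisson_lt a.+1 t)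
  (is_derive_subf (is_derive_poisson_ge b.+1 t)
    (is_derive_mulf (is_derive_poisson_ge a.+1 t) (is_derive_rho t0))))) => /=.
rewrite /S' /G /rho; move: (poisson a t) pa0 => p p0.
move: (poisson_pred a t) (poisson_pred b t) (poisson b t) => x y z.
move: (poisson_lt _ _) (poisson_ge _ _) (poisson_ge _ _) => l m n; field.
exact: p0.
Qed.

Let S_ge0 t : 0 < t -> 0 <= S t.
Proof.
move=> t0; rewrite SE // mulr_ge0 ?poisson_lt_ge0 ?(ltW t0) //.
by rewrite divr_ge0 ?G_ge0 // poisson_ge0 // ltW.
Qed.

Let S_le t : 0 < t -> S t <= poisson_lt a.+1 t.
Proof.
move=> t0; rewrite /S ler_piMr ?poisson_lt_ge0 ?(ltW t0) //.
apply: le_trans (poisson_ge_le1 b.+1 (ltW t0)).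
rewrite gerBl; apply: mulr_ge0; first by rewrite poisson_ge_ge0 ?ltW.
by rewrite divr_ge0 ?poisson_ge0 ?(ltW t0).
Qed.

Hypothesis s_le : forall c, c \in s -> (c <= a.+1)%N.
Variables (V W : R -> R) (v w : R).
Hypothesis V' : forall t, is_derive t 1 V (one_left (a.+1 :: b :: s) t).
Hypothesis W' : forall t, is_derive t 1 W (one_left (a :: b.+1 :: s) t).

(** Integration by parts without integrals: adding A S to V - W trades the lower bound - A' S of its
    derivative for A S'. *)
Let U t := V t - W t + all_empty s t * S t.

Let U_lt x y : 0 < x -> x < y -> U x < U y.
Proof.
move=> x0 xy; pose U' t : R := one_left (a.+1 :: b :: s) t - one_left (a :: b.+1 :: s) t
  + (all_empty' s t * S t + all_empty s t * S' t).
apply: (@is_derive_gt0_lt _ U U') => // z /andP[xz _].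
  have z0 := lt_le_trans x0 xz.
  apply: (is_derive_addf (is_derive_subf (V' z) (W' z))).
  exact: (is_derive_mulf (is_derive_all_empty s z) (is_derive_S z0)).
have z0 := lt_trans x0 xz.
(* This is where the bound [a.+1] on the other bins enters; the inequality for B is multiplied by G
   / p_a. *)
have GB : G z * one_left s z <= all_empty' s z * S z.
  have h := one_left_le_all_empty' z0 s_le.
  have h1 : 0 <= G z / poisson a z by rewrite divr_ge0 ?G_ge0 // poisson_ge0 // ltW.
  have := ler_wpM2l h1 h; rewrite mulrA divfK ?gt_eqF ?poisson_gt0 // => /le_trans; apply.
  by rewrite SE // mulrCA [leRHS]mulrCA (mulrC (all_empty' _ _)).
rewrite /U' one_left_move /S'.
have h1 : 0 <= all_empty s z * H z by rewrite mulr_ge0 ?H_ge0 // ltW // all_empty_gt0.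
set r := (_ / _ ^+ 2).
have r0 : r < 0 by rewrite /r pmulr_llt0 ?rho'_lt0 // invr_gt0 exprn_gt0 // poisson_gt0.
have lt0 : 0 < poisson_lt a.+1 z.
  rewrite poisson_ltS ltr_wpDl ?poisson_gt0 // poisson_lt_ge0 //; exact: ltW.
have h2 : all_empty s z * (poisson_lt a.+1 z * poisson_ge a.+1 z * r) < 0.
  by rewrite pmulr_rlt0 ?all_empty_gt0 // pmulr_rlt0 // mulr_gt0 // poisson_ge_gt0.
lra.
Qed.

Hypothesis V0 : V 0 = 0.
Hypothesis W0 : W 0 = 0.
Hypothesis Vv : V t @[t --> +oo] --> v.
Hypothesis Ww : W t @[t --> +oo] --> w.

Lemma move_ball_lt : w < v.
Proof.
have half1 : (2^-1 : R) < 1 by rewrite invf_lt1 ?ltr1n.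
have half0 : 0 < (2^-1 : R) by rewrite invr_gt0.
rewrite -subr_gt0; apply: lt_le_trans (_ : 0 < U 1) _.
  (* [S] is controlled only for positive times, as p_a vanishes at 0. So U(1/2) >= 0 is obtained as
     a limit: U(1/2) >= U t >= V t - W t, which tends to 0 as t decreases to 0. *)
  apply: le_lt_trans (U_lt half0 half1).
  have VW0 : V t - W t @[t --> 0^'+] --> (0 : R).
    apply: cvg_at_right_filter.
    suff : V t - W t @[t --> (0 : R)] --> V 0 - W 0 by rewrite V0 W0 subrr.
    by apply: cvgB; apply: differentiable_continuous; apply/derivable1_diffP;
      apply: ex_derive.
  apply: (cvgr_to_le VW0); near=> t.
  have t0 : 0 < t by near: t; exact: nbhs_right_gt.
  have th : t < 2^-1 by near: t; exact: nbhs_right_lt.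
  apply: le_trans (ltW (U_lt t0 th)).
  by rewrite lerDl mulr_ge0 ?S_ge0 // ltW // all_empty_gt0.
(* At infinity the boundary term is harmless: A S <= Q_(a+1), which tends to 0, so U 1 <= v - w. *)
have lim : V t - W t + poisson_lt a.+1 t @[t --> +oo] --> v - w + 0.
  by apply: cvgD; [exact: cvgB|exact: poisson_lt_cvg0].
rewrite -[v - w]addr0; apply: (cvgr_to_ge lim); near=> t.
have t1 : 1 < t by near: t; apply: nbhs_pinfty_gt; exact: num_real.
have t0 : 0 < t by exact: lt_trans t1.
apply: le_trans (ltW (U_lt ltr01 t1)) _.
rewrite lerD2l; apply: le_trans (S_le t0).
by rewrite ler_piMl ?S_ge0 // all_empty_le1.
Unshelve. all: by end_near. Qed.

End moving_a_ball.

(** * The removal process *)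

Section truncated_process.
Context {R : realType} {k : nat}.
Implicit Types (m : {ffun 'I_k.+1 -> nat}) (w u : nat -> 'I_k.+1).
Local Notation K := (k.+1%:R : R).

(** Truncation at horizon [N]: the value is 0 on runs not stopped by round [N]. Peeling off the
    first selection makes [mean_by] the corresponding first-step recursion for the means. *)
Fixpoint balls_by (N : nat) m w : nat :=
  if #|nonempty_bins m| == 1%N then \sum_i m i
  else if N is N'.+1 then balls_by N' (remove_ball m (w 0%N)) (fun t => w t.+1) else 0%N.

Fixpoint mean_by (N : nat) m : R :=
  if #|nonempty_bins m| == 1%N then (\sum_i m i)%:R
  else if N is N'.+1 then K^-1 * \sum_l mean_by N' (remove_ball m l) else 0.

(** [config] unfolds at the last selection, [balls_by] at the first; this reconciles the two. *)
Lemma config_recl m w t :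
  config m w t.+1 = config (remove_ball m (w 0%N)) (fun t => w t.+1) t.
Proof. by elim: t => //= t <-. Qed.

Lemma balls_by_one N m w : #|nonempty_bins m| = 1%N -> balls_by N m w = \sum_i m i.
Proof. by case: N => [|N] /= ->. Qed.

Lemma balls_byS N m w : #|nonempty_bins m| != 1%N ->
  balls_by N.+1 m w = balls_by N (remove_ball m (w 0%N)) (fun t => w t.+1).
Proof. by move=> /= /negbTE ->. Qed.

Lemma balls_by_eq0 N m w :
  (forall t, (t <= N)%N -> ~~ one_nonempty_bin m w t) -> balls_by N m w = 0%N.
Proof.
elim: N m w => [|N IH] m w h; have h0 : #|nonempty_bins m| != 1%N := h 0%N isT.
  by rewrite /= (negbTE h0).
rewrite balls_byS //; apply: IH => t tN.
by have := h t.+1 tN; rewrite /one_nonempty_bin config_recl.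
Qed.

Lemma balls_by_stopped N m w t : (t <= N)%N -> one_nonempty_bin m w t ->
  (forall t', (t' < t)%N -> ~~ one_nonempty_bin m w t') ->
  balls_by N m w = \sum_i config m w t i.
Proof.
elim: t N m w => [|t IH] N m w tN ht h; first exact/balls_by_one/eqP.
case: N tN => // N tN; have h0 : #|nonempty_bins m| != 1%N := h 0%N isT.
rewrite config_recl balls_byS //; apply: IH => //.
  by move: ht; rewrite /one_nonempty_bin config_recl.
by move=> t' tt'; have := h t'.+1 tt'; rewrite /one_nonempty_bin config_recl.
Qed.

Lemma sum_nonempty_bins m : (\sum_(i in nonempty_bins m) m i = \sum_i m i)%N.
Proof.
rewrite [RHS](bigID (mem (nonempty_bins m))) /= [X in (_ + X)%N]big1 ?addn0 // => i.
by rewrite inE lt0n negbK => /eqP.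
Qed.

(** As a function of the horizon the truncation is 0 up to the stopping round and constant
    afterwards, which yields both its monotonicity and its limit. *)
Lemma balls_by_cases m w : (forall N, balls_by N m w = 0%N) /\ remaining_balls m w = 0%N \/
  exists T, forall N, balls_by N m w = if (T <= N)%N then remaining_balls m w else 0%N.
Proof.
rewrite /remaining_balls /stopping_round; case: pselect => [ex_t|nex]; last first.
  left; split => // N; apply: balls_by_eq0 => t _; apply/negP => ht; apply: nex.
  by exists t.
right; case: ex_minnP => T hT minT; exists T => N; rewrite sum_nonempty_bins.
case: leqP => [TN|NT].
  by apply: balls_by_stopped => // t; rewrite ltnNge; apply: contra; exact: minT.
apply: balls_by_eq0 => t tN; apply/negP => /minT; rewrite leqNgt.
by rewrite (leq_ltn_trans tN NT).
Qed.

Lemma mean_by_ge0 N m : 0 <= mean_by N m.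
Proof.
elim: N m => [|N IH] m /=; case: ifP => // _.
by rewrite mulr_ge0 ?invr_ge0 // sumr_ge0.
Qed.

Lemma mean_by_nondecreasing m : nondecreasing_seq (mean_by ^~ m).
Proof.
apply/nondecreasing_seqP => N; elim: N m => [|N IH] m.
  rewrite /=; case: ifP => // _; rewrite mulr_ge0 ?invr_ge0 // sumr_ge0 // => l _.
  exact: (mean_by_ge0 0).
rewrite [leLHS]/= [leRHS]/=; case: ifP => // _.
by rewrite ler_wpM2l ?invr_ge0 // ler_sum.
Qed.

Lemma leq_sum_remove_ball m l : (\sum_i remove_ball m l i <= \sum_i m i)%N.
Proof. by apply: leq_sum => i _; rewrite ffunE leq_subr. Qed.

Lemma mean_by_le N m : mean_by N m <= (\sum_i m i)%:R.
Proof.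
elim: N m => [|N IH] m /=; case: ifP => // _.
rewrite ler_pdivrMl //; apply: le_trans (_ : \sum_(l < k.+1) (\sum_i m i)%:R <= _).
  by apply: ler_sum => l _; apply: le_trans (IH _) _; rewrite ler_nat leq_sum_remove_ball.
by rewrite sumr_const card_ord mulr_natl.
Qed.

Lemma mean_by_cvg m : cvgn (mean_by ^~ m).
Proof.
apply: nondecreasing_is_cvgn; first exact: mean_by_nondecreasing.
by exists (\sum_i m i)%:R => _ [N _ <-]; exact: mean_by_le.
Qed.

(** The real-valued form of f; [expected_remainingE] identifies it with the expectation. *)
Definition mean_remaining m : R := limn (mean_by ^~ m).

Lemma mean_remaining_one m : #|nonempty_bins m| = 1%N ->
  mean_remaining m = (\sum_i m i)%:R.
Proof.
move=> m1; rewrite /mean_remaining (_ : mean_by ^~ m = cst (\sum_i m i)%:R) ?lim_cst //.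
by apply/funext => -[|N] /=; rewrite m1.
Qed.

Lemma mean_remaining_step m : #|nonempty_bins m| != 1%N ->
  K * mean_remaining m = \sum_l mean_remaining (remove_ball m l).
Proof.
move=> m1; apply/esym; apply: (canRL (mulVKf _)) => //.
apply/esym; apply: cvg_lim => //; rewrite -cvg_shiftS.
under eq_fun do rewrite /= (negbTE m1).
apply: cvgM; first exact: cvg_cst.
apply: cvg_big => [|l _]; [exact: add_continuous|exact: mean_by_cvg].
Qed.

(** * Expectation under the product measure *)

Section expectation.
Variable P : probability (selections k) R.
Hypothesis hP : uniform_product_measure P.

(** The singletons put the event in the rectangular form of [uniform_product_measure]. *)
Definition cylinder s u : set (selections k) :=
  [set w : nat -> 'I_k.+1 | forall t, (t < s)%N -> w t \in [set u t]%SET].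

Lemma measurable_coordinate s i :
  measurable ([set w : nat -> 'I_k.+1 | w s = i] : set (selections k)).
Proof. by apply: sub_sigma_algebra; exists s, i. Qed.

Lemma measurable_cylinder s u : measurable (cylinder s u).
Proof.
rewrite (_ : cylinder s u = \bigcap_(t in [set t | (t < s)%N])
  ([set w : nat -> 'I_k.+1 | w t = u t] : set (selections k))).
  by apply: bigcap_measurableType => // t _; exact: measurable_coordinate.
by apply/seteqP; split=> w /= h t /h; rewrite ?inE => /eqP.
Qed.

Lemma prob_cylinder s u : P (cylinder s u) = (K ^- s)%:E.
Proof.
rewrite [LHS](hP s (fun t => [set u t]%SET)); congr EFin.
rewrite (eq_bigr (fun _ => K^-1)) => [|t _]; last by rewrite cards1 div1r.
by rewrite prodr_const card_ord exprVn.
Qed.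

Lemma measurable_balls_by N m s :
  measurable_fun setT (fun w : selections k =>
    (balls_by N m (fun t => w (s + t)%N))%:R : R).
Proof.
elim: N m s => [|N IH] m s; first by rewrite /=; case: ifP => _; exact: measurable_cst.
have [m1|m1] := eqVneq #|nonempty_bins m| 1%N.
  rewrite (_ : (fun _ => _) = cst (\sum_i m i)%:R); first exact: measurable_cst.
  by apply/funext => w; rewrite balls_by_one.
(* Splitting on the value of [w s] gives a finite sum of indicators times functions that are
   measurable by induction. *)
rewrite (_ : (fun _ => _) = fun w : selections k => \sum_(l < k.+1)
    \1_([set w : nat -> 'I_k.+1 | w s = l] : set (selections k)) w *
    (balls_by N (remove_ball m l) (fun t => w (s.+1 + t)%N))%:R : R).
  apply: measurable_sum => l; apply: measurable_funM; last exact: IH.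
  by apply: measurable_indic; exact: measurable_coordinate.
apply/funext => w; rewrite balls_byS // (bigD1 (w s)) //= big1 ?addr0 => [|l lws].
  rewrite indicE mem_set // mul1r addn0; congr (balls_by _ _ _)%:R.
  by apply/funext => t; rewrite addnS.
by rewrite indicE memNset ?mul0r //= => e; rewrite e eqxx in lws.
Qed.

(** Integrating over a cylinder plays the role of conditioning on the first [s] selections. The next
    selection splits it into [k.+1] cylinders of equal measure, matching the recursion of
    [mean_by]. *)
Lemma integral_balls_by N m s u :
  (\int[P]_(w in cylinder s u) (balls_by N m (fun t => w (s + t)%N))%:R%:E =
  (K ^- s * mean_by N m)%:E)%E.
Proof.
have cstE s' u' c : (\int[P]_(w in cylinder s' u') c%:E = (K ^- s' * c)%:E)%E.
  rewrite integral_cst; last exact: measurable_cylinder.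
  by rewrite [X in (_ * X)%E]prob_cylinder -EFinM mulrC.
elim: N m s u => [|N IH] m s u; first by rewrite /=; case: ifP => _; exact: cstE.
have [m1|m1] := eqVneq #|nonempty_bins m| 1%N.
  by rewrite /= m1; exact: cstE.
pose v l t := if t == s then l else u t.
have cylE : cylinder s u = \big[setU/set0]_(l <- index_enum 'I_k.+1) cylinder s.+1 (v l).
  rewrite -bigcup_seq; apply/seteqP; split=> w /=.
    move=> h; exists (w s); first by rewrite /= mem_index_enum.
    move=> t; rewrite ltnS leq_eqVlt inE /v => /predU1P[->|ts]; first by rewrite eqxx.
    by rewrite ltn_eqF //; have := h t ts; rewrite inE.
  move=> [l _ h] t ts; have := h t (ltnW ts); rewrite /v ltn_eqF //.
rewrite cylE ge0_integral_bigsetU; last 5 first.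
- by move=> l; exact: measurable_cylinder.
- exact: index_enum_uniq.
- move=> i j _ _ [w [/(_ s (ltnSn s))+ /(_ s (ltnSn s))]].
  by rewrite /v !inE eqxx => /eqP -> /eqP.
- apply/measurable_EFinP. exact: (measurable_funTS (measurable_balls_by N.+1 m s)).
- by move=> w _; rewrite lee_fin.
have -> : mean_by N.+1 m = K^-1 * \sum_l mean_by N (remove_ball m l).
  by rewrite /= (negbTE m1).
rewrite (eq_bigr (fun l => (K ^- s.+1 * mean_by N (remove_ball m l))%:E)) => [|l _].
  by rewrite sumEFin -mulr_sumr exprSr invfM -mulrA.
rewrite -(IH _ _ (v l)); apply: eq_integral => w; rewrite inE => /(_ s (ltnSn s)).
rewrite /v inE eqxx => /eqP ws; rewrite balls_byS //.
rewrite addn0 ws; congr (balls_by _ _ _)%:R%:E.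
by apply/funext => t; rewrite addnS.
Qed.

(** Monotone convergence in the horizon; on runs that never stop, all truncations and the limit are
    0. *)
Lemma expected_remainingE m : expected_remaining P m = (mean_remaining m)%:E.
Proof.
rewrite /expected_remaining unlock.
have -> : (\int[P]_w (remaining_balls m w)%:R%:E)%E =
    (\int[P]_w limn (fun N => (balls_by N m w)%:R%:E))%E.
  apply: eq_integral => w _; apply/esym/cvg_lim => //.
  have [[h ->]|[T h]] := balls_by_cases m w.
    by under eq_fun do rewrite h; exact: cvg_cst.
  apply: cvg_near_cst; exists T => // N /= TN; by rewrite h TN.
have mono w : {homo (fun N => balls_by N m w) : N N' / (N <= N')%N}.
  move=> N N' NN'; have [[h _]|[T h]] := balls_by_cases m w; first by rewrite !h.
  by rewrite !h; case: (leqP T N) => // TN; rewrite (leq_trans TN NN').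
have meas N : measurable_fun [set: selections k]
    (fun w : selections k => (balls_by N m w)%:R%:E : \bar R).
  by apply/measurable_EFinP; exact: (measurable_balls_by N m 0).
rewrite monotone_convergence; last 4 first.
- exact: measurableT.
- exact: meas.
- by move=> N w _; rewrite lee_fin.
- by move=> w _ N N' NN'; rewrite lee_fin ler_nat mono.
have cyl0 u : cylinder 0 u = setT by apply/seteqP; split.
under eq_fun => N.
  rewrite -(cyl0 (fun=> ord0)).
  rewrite (integral_balls_by N m 0 (fun=> ord0)) expr0 invr1 mul1r; over.
by rewrite -EFin_lim //; exact: mean_by_cvg.
Qed.

End expectation.
End truncated_process.

(** * Antiderivatives of Psi and their limits *)

Section potential.
Context {R : realType} {k : nat}.
Implicit Types (m : {ffun 'I_k.+1 -> nat}) (l : 'I_k.+1) (r : seq 'I_k.+1) (t : R).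

Let map_remove_ball m l r : l \notin r -> map (remove_ball m l) r = map m r.
Proof.
move=> lr; apply/eq_in_map => i ir; rewrite ffunE (_ : (i == l) = false) ?subn0 //.
by apply: contraNF lr => /eqP <-.
Qed.

Let poisson_geB n t : poisson_ge (n - 1) t - poisson_ge n t = poisson_pred n t.
Proof. by case: n => [|n]; rewrite ?subrr // subn1 /= (poisson_geS n); ring. Qed.

Let poisson_ltB n t : poisson_lt (n - 1) t - poisson_lt n t = - poisson_pred n t.
Proof. by rewrite -poisson_geB /poisson_ge; ring. Qed.

(** Backward equation: each bin loses a ball at rate 1, and p_(n-1) = F_(n-1) - F_n. An empty bin
    contributes 0 on both sides. *)
Lemma all_empty'_map m r t : uniq r -> all_empty' (map m r) t =
  \sum_(l <- r) (all_empty (map (remove_ball m l) r) t - all_empty (map m r) t).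
Proof.
elim: r => [|i r IH] /=; first by rewrite big_nil.
move=> /andP[ir /IH ->]; rewrite big_cons /= map_remove_ball // !all_empty_cons.
rewrite ffunE eqxx -mulrBl poisson_geB; congr (_ + _).
rewrite mulr_sumr [LHS]big_seq [RHS]big_seq; apply: eq_bigr => l lr.
rewrite all_empty_cons ffunE (_ : (i == l) = false) ?subn0 ?mulrBr //.
by apply: contraNF ir => /eqP ->.
Qed.

Lemma one_left'_map m r t : uniq r -> one_left' (map m r) t =
  \sum_(l <- r) (one_left (map (remove_ball m l) r) t - one_left (map m r) t).
Proof.
elim: r => [|i r IH] /=; first by rewrite big_nil.
move=> /andP[ir ur]; rewrite IH // all_empty'_map //.
rewrite big_cons /= map_remove_ball // !one_left_cons ffunE eqxx /=.
rewrite addrACA; congr (_ + _); first by rewrite -poisson_ltB -poisson_geB; ring.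
rewrite [X in X + _ = _]mulr_sumr [X in _ + X = _]mulr_sumr -big_split /=.
rewrite [LHS]big_seq [RHS]big_seq; apply: eq_bigr => l lr.
rewrite one_left_cons ffunE (_ : (i == l) = false) ?subn0; first by ring.
by apply: contraNF ir => /eqP ->.
Qed.

Definition bins m : seq nat := [seq m l | l <- index_enum 'I_k.+1].

Lemma remove_ball_empty m l : l \notin nonempty_bins m -> remove_ball m l = m.
Proof.
rewrite inE -eqn0Ngt => /eqP ml; apply/ffunP => i; rewrite ffunE.
by have [->|] := eqVneq i l; rewrite ?ml ?subn0.
Qed.

Lemma sum_remove_ball m l : l \in nonempty_bins m ->
  (\sum_i m i = (\sum_i remove_ball m l i).+1)%N.
Proof.
rewrite inE => ml; rewrite [LHS](bigD1 l) //= [in RHS](bigD1 l) //= ffunE eqxx.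
rewrite -addSn subn1 prednK //; congr addn; apply: eq_bigr => i /negbTE il.
by rewrite ffunE il subn0.
Qed.

Lemma one_left'_bins m t : one_left' (bins m) t =
  \sum_(l in nonempty_bins m) one_left (bins (remove_ball m l)) t
  - #|nonempty_bins m|%:R * one_left (bins m) t.
Proof.
rewrite one_left'_map ?index_enum_uniq // (bigID (mem (nonempty_bins m))) /=.
rewrite [X in _ + X]big1 ?addr0 => [|l /remove_ball_empty ->]; last exact: subrr.
by rewrite big_split /= sumr_const mulNrn mulr_natl.
Qed.

Lemma count_bins m : count (fun c => 0 < c)%N (bins m) = #|nonempty_bins m|.
Proof.
by rewrite count_map -sum1_count -sum1_card; apply: eq_bigl => l; rewrite /= [in RHS]inE.
Qed.

Lemma mean_remaining0 m : (\sum_i m i)%N = 0%N -> mean_remaining m = 0 :> R.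
Proof.
move=> m0; apply: cvg_lim => //; rewrite (_ : mean_by ^~ m = cst 0); first exact: cvg_cst.
apply/funext => N; apply/le_anti; rewrite mean_by_ge0 andbT.
by apply: le_trans (mean_by_le N m) _; rewrite m0.
Qed.

(** Selections of empty bins cancel from [mean_remaining_step]. With a single non-empty bin the
    process has already stopped, and the extra 1 accounts for the ball removed; so one recursion
    holds for every non-zero [m]. *)
Lemma mean_remaining_nonempty m : m != [ffun=> 0%N] ->
  #|nonempty_bins m|%:R * mean_remaining m =
  \sum_(l in nonempty_bins m) mean_remaining (remove_ball m l)
  + (#|nonempty_bins m| == 1%N)%:R :> R.
Proof.
move=> m0; have [m1|m1] := eqVneq #|nonempty_bins m| 1%N; last first.
  have := mean_remaining_step (R := R) m1.
  rewrite (bigID (mem (nonempty_bins m))) /=.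
  rewrite [X in _ + X](eq_bigr (fun _ => mean_remaining m)) => [|l /remove_ball_empty -> //].
  rewrite sumr_const addr0 -[X in X%:R * _](card_ord k.+1) -(cardC (mem (nonempty_bins m))).
  by rewrite natrD mulrDl -[X in _ = _ + X -> _]mulr_natl => /addIr.
rewrite m1 mul1r mean_remaining_one //.
have /cards1P[l ml] := introT eqP m1.
have ml' i : (0 < m i)%N = (i == l) by have /finset.setP/(_ i) := ml; rewrite !inE.
have lm : l \in nonempty_bins m by rewrite inE ml'.
rewrite ml big_set1 (sum_remove_ball lm) -natr1; congr (_ + _).
(* If the bin held one ball, its removal leaves no ball at all, a configuration whose process never
   stops and has mean 0. *)
have [s0|s0] := eqVneq (\sum_i remove_ball m l i)%N 0%N.
  by rewrite s0 mean_remaining0.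
rewrite mean_remaining_one //; apply/eqP/cards1P; exists l; apply/setP => i.
rewrite !inE; apply/idP/eqP => [|->].
  by rewrite ffunE => il; apply/eqP; rewrite -ml'; apply: leq_trans il (leq_subr _ _).
move: s0; rewrite (bigD1 l) //= big1 ?addn0 ?lt0n // => i' il.
apply/eqP; rewrite ffunE subn_eq0 leqNgt; apply: contra il => h.
by rewrite -ml' (leq_trans _ h).
Qed.

Lemma mean_remaining_potential m : exists V : R -> R,
  [/\ forall t, is_derive t 1 V (one_left (bins m) t), V 0 = 0 &
      V t @[t --> +oo] --> mean_remaining m].
Proof.
have [n] := ubnP (\sum_i m i)%N; elim: n => // n IH in m *; rewrite ltnS => mn.
have [m0|m0] := eqVneq m [ffun=> 0%N].
  have s0 : (\sum_i m i = 0)%N by rewrite m0 big1 // => i _; rewrite ffunE.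
  exists (cst 0); split => //; last by rewrite mean_remaining0 //; exact: cvg_cst.
  move=> t; apply: (is_derive_eq (is_derive_cst _ _ _)).
  rewrite /bins; elim: (index_enum _) => [|i r IHr]; first by rewrite one_left_nil.
  by rewrite /= one_left_cons -IHr m0 ffunE poisson_lt0 mul0r mulr0 addr0.
pose E := nonempty_bins m.
have /choice[V VP] : forall l, exists V : R -> R, l \in E ->
    [/\ forall t, is_derive t 1 V (one_left (bins (remove_ball m l)) t), V 0 = 0 &
      V t @[t --> +oo] --> (mean_remaining (remove_ball m l) : R)].
  move=> l; case: (boolP (l \in E)) => lE; last by exists (cst 0).
  have [|V VP] := IH (remove_ball m l); last by exists V.
  by rewrite (sum_remove_ball lE) in mn.
have E0 : (#|E|%:R : R) != 0.
  rewrite pnatr_eq0 cards_eq0; apply: contraNneq m0 => E0; apply/eqP/ffunP => l.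
  rewrite ffunE; apply/eqP; rewrite eqn0Ngt; apply/negP => ml.
  suff : l \in E by rewrite E0 inE.
  by rewrite inE.
(* [one_left'_bins] solved for Psi: |E| Psi is the sum of the Psi's after one removal minus Psi'.
   The constant is the value of Psi at 0, so that V(0) = 0; at infinity Psi vanishes and the
   recursion of [mean_remaining_nonempty] remains. *)
exists (fun t => #|E|%:R^-1 *
  (\sum_(l in E) V l t - one_left (bins m) t + (#|E| == 1%N)%:R)); split.
- move=> t.
  have D : is_derive t 1 (fun u => \sum_(l in E) V l u)
      (\sum_(l in E) one_left (bins (remove_ball m l)) t).
    by apply: is_derive_sumf => l lE; have [] := VP l lE.
  have := is_derive_mulf (is_derive_cst (#|E|%:R^-1 : R) t 1)
    (is_derive_addf (is_derive_subf D (is_derive_one_left (bins m) t))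
      (is_derive_cst ((#|E| == 1%N)%:R : R) t 1)).
  move=> /is_derive_eq; apply; rewrite one_left'_bins -/E mul0r add0r addr0 opprB.
  by rewrite addrC subrK mulKf.
- rewrite one_left_at0 count_bins -/E big1 => [|l lE].
    by rewrite sub0r addNr mulr0.
  by have [] := VP l lE.
- rewrite -[mean_remaining m](mulKf E0) mean_remaining_nonempty // -/E.
  apply: cvgM; first exact: cvg_cst.
  apply: cvgD; last exact: cvg_cst.
  rewrite -[X in _ --> X]subr0; apply: cvgB; last exact: one_left_cvg0.
  apply: cvg_big => [|l lE]; first exact: add_continuous.
  by have [] := VP l lE.
Qed.

End potential.

(** * Balancing two bins, and minimality *)

Lemma perm_bins (k : nat) (m : {ffun 'I_k.+1 -> nat}) (i j : 'I_k.+1) : j != i ->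
  perm_eq (bins m)
    [:: m i, m j & [seq m l | l <- rem j (rem i (index_enum 'I_k.+1))]].
Proof.
move=> ji; apply: (perm_map m (t := [:: i, j & rem j (rem i (index_enum _))])).
rewrite (permPl (perm_to_rem (mem_index_enum i))) perm_cons perm_to_rem //.
by rewrite rem_mem // mem_index_enum.
Qed.

Lemma mean_remaining_move_lt (R : realType) (k a b : nat) (m : {ffun 'I_k.+1 -> nat})
    (i j : 'I_k.+1) : m i = a.+1 -> m j = b -> (b < a)%N ->
    (forall l, (m l <= a.+1)%N) ->
  let m' : {ffun 'I_k.+1 -> nat} :=
    [ffun l => if l == i then a else if l == j then b.+1 else m l] in
  (\sum_l m' l = \sum_l m l)%N /\ mean_remaining m' < mean_remaining m :> R.
Proof.
move=> mi mj ba mle m'.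
have ji : j != i.
  apply: contraTneq ba => ji; rewrite -leqNgt -mj ji mi; exact: leqnSn.
have m'i : m' i = a by rewrite ffunE eqxx.
have m'j : m' j = b.+1 by rewrite ffunE (negbTE ji) eqxx.
have m'l l : l != i -> l != j -> m' l = m l.
  by move=> /negbTE li /negbTE lj; rewrite ffunE li lj.
split.
  rewrite [LHS](bigD1 i) // [RHS](bigD1 i) //= [in LHS](bigD1 j) // [in RHS](bigD1 j) //=.
  rewrite mi mj m'i m'j addSnnS addnA addnA addnS addSn; congr (_.+1 + _)%N.
  by apply: eq_bigr => l /andP[]; exact: m'l.
pose s := [seq m l | l <- rem j (rem i (index_enum 'I_k.+1))].
have s' : [seq m' l | l <- rem j (rem i (index_enum 'I_k.+1))] = s.
  apply/eq_in_map => l; rewrite mem_rem_uniq ?rem_uniq ?index_enum_uniq //.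
  rewrite inE mem_rem_uniq ?index_enum_uniq // inE => /and3P[lj li _]; exact: m'l.
have [V [V' V0 Vv]] := mean_remaining_potential (R := R) m.
have [W [W' W0 Ww]] := mean_remaining_potential (R := R) m'.
have s_le c : c \in s -> (c <= a.+1)%N by move=> /mapP[l _ ->].
apply: (move_ball_lt ba s_le _ _ V0 W0 Vv Ww) => t.
  by have := V' t; rewrite (perm_one_left _ (perm_bins m ji)) mi mj.
by have := W' t; rewrite (perm_one_left _ (perm_bins m' ji)) m'i m'j s'.
Qed.

Theorem theorem1 (R : realType) (n k : nat) (hn : (2 <= n)%N) (hk : (2 <= k.+1)%N)
    (P : probability (selections k) R) (hP : uniform_product_measure P)
    (m : {ffun 'I_k.+1 -> nat}) (hm : (\sum_(i < k.+1) m i)%N = n)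
    (hmin : forall m' : {ffun 'I_k.+1 -> nat}, (\sum_(i < k.+1) m' i)%N = n ->
      (expected_remaining P m <= expected_remaining P m')%E) :
  forall i j : 'I_k.+1, `|(m i)%:Z - (m j)%:Z| <= 1.
Proof.
suff ub i j : (m i <= (m j).+1)%N.
  by move=> i j; have := ub i j; have := ub j i; rewrite ler_norml; lia.
rewrite leqNgt; apply/negP => ji.
(* The ball is taken from a fullest bin [p] rather than from [i], since the comparison requires all
   other bins to hold at most as many balls; the gap to [j] is still at least 2. *)
case: (@arg_maxnP _ i predT m isT) => p _ pmax.
have jp : ((m j).+2 <= m p)%N := leq_trans ji (pmax i isT).
case mp : (m p) => [|a]; first by rewrite mp in jp.
have ba : (m j < a)%N by rewrite mp in jp.
have [|sum_m' lt_m'] := mean_remaining_move_lt R mp erefl ba.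
  by move=> l; rewrite -mp; exact: pmax.
have := hmin _ (etrans sum_m' hm).
by rewrite !expected_remainingE // lee_fin leNgt lt_m'.
Qed.
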